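(* Let $\{A_i\}_{i\in I}$ be an arbitrary family of finite groups and, for each $i\in I$, let $A_i^*$ be a covering group of $A_i$. Then the second nilpotent product $\prod^{\overset{2}{*}}_{i\in I}A_i^*$ of the groups $A_i^*$ is a covering group of the direct product $\prod^{\times}_{i\in I}A_i$.
   Context: A covering group of a group $G$ is a group $G^*$ with a normal subgroup $A$ such that $G^*/A\cong G$, $A\subseteq Z(G^* )\cap[G^*,G^*]$ and $A\cong M(G)$, where $M(G)$ is the Schur multiplier of $G$ ($M(G)=(R\cap F')/[R,F]$ for any free presentation $G\cong F/R$). $\prod^{\times}_{i\in I}$ denotes the (restricted) direct product, i.e. the direct limit of the direct products over finite subsets of $I$ under the inclusion maps, and $\prod^{*}_{i\in I}$ denotes the free product. The second nilpotent product of a family of groups $\{A_i^*\}_{i\in I}$ is $$\prod^{\overset{2}{*}}_{i\in I}A_i^*=\frac{\prod^{*}_{i\in I}A_i^*}{\gamma_3\left(\prod^{*}_{i\in I}A_i^*\right)\cap[A_i^*]^*},$$ where $\gamma_3$ is the third term of the lower central series and $[A_i^*]^*$ is the kernel of the natural epimorphism $\prod^{*}_{i\in I}A_i^*\to\prod^{\times}_{i\in I}A_i^*$, equivalently the normal closure in $\prod^{*}_{i\in I}A_i^*$ of the subgroups $[A_i^*,A_j^*]$, $i\ne j$. *)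

(* Defs.v *)
From HB Require Import structures.
From mathcomp Require Import all_boot all_fingroup.
From mathcomp Require Import generic_quotient.
From mathcomp Require Import boolp classical_sets cardinality.

Set Implicit Arguments.
Unset Strict Implicit.
Unset Printing Implicit Defensive.

Local Open Scope classical_set_scope.
Local Open Scope group_scope.
Local Open Scope quotient_scope.

Import Algebra.

#[local] Obligation Tactic := idtac.

(* Groups are possibly infinite: [groupType].  Subsets are classical, [set G].
   [UMagmaMorphism.type G H] is the library's type of group morphisms that
   comes with the morphism lemmas [gmulf1], [gmulfV], [gmulfR] used below. *)
Notation "{ 'hom' G -> H }" := (UMagmaMorphism.type G%type H%type)
  (at level 0, G at level 98, H at level 99,
   format "{ 'hom'  G  ->  H }") : type_scope.

Definition isomorphic (G H : groupType) : Prop :=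
  exists f : {hom G -> H}, bijective f.

Record subgroup (G : groupType) := Subgroup {
  sg_mem :> G -> Prop;
  sg_closed : group_closed [in (sg_mem : set G)] }.

Coercion sg_set (G : groupType) (H : subgroup G) : set G := sg_mem H.

Record nsubgroup (G : groupType) := NSubgroup {
  nsg_sub :> subgroup G;
  nsg_conj : forall x y : G, nsg_sub x -> nsg_sub (x ^ y) }.

Section SubgroupTheory.
Variables (G : groupType).
Implicit Types (H : subgroup G) (N : nsubgroup G).

Lemma sg1 H : H 1.
Proof. by have [/set_mem] := sg_closed H. Qed.

Lemma sgV H x : H x -> H x^-1.
Proof.
by move=> Hx; apply/set_mem/(group_closedV (sg_closed H))/mem_set.
Qed.

Lemma sgM H x y : H x -> H y -> H (x * y).
Proof.
by move=> Hx Hy; apply/set_mem/(group_closedM (sg_closed H)); apply/mem_set.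
Qed.

Lemma group_closedP (A : set G) :
  A 1 -> (forall x y, A x -> A y -> A (x * y)) -> (forall x, A x -> A x^-1) ->
  group_closed [in A].
Proof.
move=> A1 AM AV; split; first exact/mem_set.
by move=> x y /set_mem Ax /set_mem Ay; apply/mem_set/AM => //; apply: AV.
Qed.

Definition subgroup_of H : Type := set_type H.
HB.instance Definition _ H := SubChoice.on (subgroup_of H).
HB.instance Definition _ H :=
  SubChoice_isSubGroup.Build G [in sg_set H] (subgroup_of H) (sg_closed H).

Definition subgroup_incl H : subgroup_of H -> G := val.
Lemma subgroup_incl_monoid_morphism H : monoid_morphism (@subgroup_incl H).
Proof. by split. Qed.
HB.instance Definition _ H := isUMagmaMorphism.Build (subgroup_of H) G
  (@subgroup_incl H) (subgroup_incl_monoid_morphism H).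

End SubgroupTheory.

Section SubgroupConstructions.
Variable G : groupType.

Program Definition whole : nsubgroup G := @NSubgroup G (@Subgroup G setT _) _.
Next Obligation. by apply: group_closedP. Qed.
Next Obligation. by []. Qed.

Program Definition sgI (H K : nsubgroup G) : nsubgroup G :=
  @NSubgroup G (@Subgroup G (H `&` K) _) _.
Next Obligation.
move=> H K; apply: group_closedP => [|x y [? ?] [? ?]|x [? ?]].
- by split; apply: sg1.
- by split; apply: sgM.
- by split; apply: sgV.
Qed.
Next Obligation. by move=> H K x y [? ?]; split; apply: nsg_conj. Qed.

Definition generated_set (A : set G) : set G :=
  [set x | forall H : subgroup G, A `<=` H -> H x].

Lemma generated_closed (A : set G) : group_closed [in generated_set A].
Proof.
apply: group_closedP => [H _|x y Ax Ay H AH|x Ax H AH].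
- exact: sg1.
- by apply: sgM; [apply: Ax|apply: Ay].
- by apply: sgV; apply: Ax.
Qed.

Definition generated_sg (A : set G) : subgroup G :=
  Subgroup (generated_closed A).

Lemma sub_generated (A : set G) : A `<=` generated_sg A.
Proof. by move=> x Ax H; apply. Qed.

Program Definition conj_preim (H : subgroup G) (y : G) : subgroup G :=
  @Subgroup G [set x | H (x ^ y)] _.
Next Obligation.
move=> H y; apply: group_closedP => /= [|a b Ha Hb|a Ha].
- by rewrite conj1g; apply: sg1.
- by rewrite conjMg; apply: sgM.
- by rewrite conjVg; apply: sgV.
Qed.

Lemma generated_conj (A : set G) :
  (forall x y, A x -> A (x ^ y)) ->
  forall x y, generated_sg A x -> generated_sg A (x ^ y).
Proof.
move=> AJ x y Ax H AH; apply: (Ax (conj_preim H y)) => z Az /=.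
by apply/AH/AJ.
Qed.

Lemma commutators_conj (H K : nsubgroup G) x y :
  [set z | exists h k : G, [/\ H h, K k & z = [~ h, k]]] x ->
  [set z | exists h k : G, [/\ H h, K k & z = [~ h, k]]] (x ^ y).
Proof.
move=> [h [k [Hh Kk ->]]]; exists (h ^ y), (k ^ y).
by rewrite conjRg; split => //; apply: nsg_conj.
Qed.

Definition commutator_sg (H K : nsubgroup G) : nsubgroup G :=
  NSubgroup (generated_conj (@commutators_conj H K)).

Definition derived_sg : nsubgroup G := commutator_sg whole whole.

(* [lower_central n] is the (n+1)-st term: [lower_central 0] is the group. *)
Fixpoint lower_central (n : nat) : nsubgroup G :=
  if n is m.+1 then commutator_sg (lower_central m) whole else whole.

Definition gamma3 : nsubgroup G := lower_central 2.

Lemma conjugates_conj (A : set G) x y :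
  [set z | exists a g : G, A a /\ z = a ^ g] x ->
  [set z | exists a g : G, A a /\ z = a ^ g] (x ^ y).
Proof. by move=> [a [g [Aa ->]]]; exists a, (g * y); rewrite conjgM. Qed.

Definition normal_closure (A : set G) : nsubgroup G :=
  NSubgroup (generated_conj (@conjugates_conj A)).

Lemma normal_closure_min (A : set G) (N : nsubgroup G) :
  A `<=` N -> normal_closure A `<=` N.
Proof.
by move=> AN x; apply => _ [a [g [/AN Na ->]]]; apply: nsg_conj.
Qed.

Definition center_sg : set G := [set x | forall y, commute x y].

End SubgroupConstructions.

Arguments center_sg G : clear implicits.

Section Preimages.
Variables (G H : groupType) (f : {hom G -> H}).

Program Definition preim_sg (K : nsubgroup H) : nsubgroup G :=
  @NSubgroup G (@Subgroup G (f @^-1` K) _) _.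
Next Obligation.
move=> K; apply: group_closedP => /= [|a b Ha Hb|a Ha].
- by rewrite /preimage /= gmulf1; apply: sg1.
- by rewrite /preimage /= gmulfM; apply: sgM.
- by rewrite /preimage /= gmulfV; apply: sgV.
Qed.
Next Obligation.
by move=> K x y /=; rewrite /preimage /= gmulfJ; apply: nsg_conj.
Qed.

Program Definition kernel_sg : nsubgroup G :=
  @NSubgroup G (@Subgroup G [set x | f x = 1] _) _.
Next Obligation.
apply: group_closedP => /= [|a b fa fb|a fa].
- exact: gmulf1.
- by rewrite gmulfM fa fb mulg1.
- by rewrite gmulfV fa invg1.
Qed.
Next Obligation. by move=> x y /= fx; rewrite gmulfJ fx conj1g. Qed.

End Preimages.

Section Quotient.
Variables (G : groupType) (N : nsubgroup G).

Definition cosetb (x y : G) : bool := `[< N (x^-1 * y) >].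

Lemma cosetb_refl : reflexive cosetb.
Proof. by move=> x; apply/asboolP; rewrite mulVg; apply: sg1. Qed.
Lemma cosetb_sym : symmetric cosetb.
Proof.
move=> x y; apply/asbool_equiv_eq; split => /sgV; by rewrite invgM invgK.
Qed.
Lemma cosetb_trans : transitive cosetb.
Proof.
move=> y x z /asboolP xy /asboolP yz; apply/asboolP.
by rewrite -(mulgK y x^-1) -mulgA; apply: sgM.
Qed.

Canonical coset_equiv := EquivRel cosetb cosetb_refl cosetb_sym cosetb_trans.

Definition quotient_group : Type := {eq_quot cosetb}.
HB.instance Definition _ := Choice.on quotient_group.

Definition cosetg (x : G) : quotient_group := \pi_({eq_quot cosetb}) x.

Lemma cosetP x y : cosetg x = cosetg y <-> N (x^-1 * y).
Proof.
split=> [/eqquotP/asboolP//|Nxy]; apply/eqquotP; exact/asboolP.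
Qed.

Lemma coset_ind (P : quotient_group -> Prop) :
  (forall x, P (cosetg x)) -> forall q, P q.
Proof. by move=> Pc q; rewrite -[q]reprK; apply: Pc. Qed.

Definition coset_repr (q : quotient_group) : G := repr (q : {eq_quot cosetb}).
Lemma coset_reprK q : cosetg (coset_repr q) = q.
Proof. exact: reprK. Qed.
Lemma coset_reprP x : N ((coset_repr (cosetg x))^-1 * x).
Proof. by apply/cosetP; rewrite coset_reprK. Qed.

Definition quotient_mul (p q : quotient_group) :=
  cosetg (coset_repr p * coset_repr q).
Definition quotient_inv (p : quotient_group) := cosetg (coset_repr p)^-1.

Lemma coset_mulE x y : quotient_mul (cosetg x) (cosetg y) = cosetg (x * y).
Proof.
apply/cosetP; rewrite invgM.
set b := coset_repr _; set a := coset_repr _.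
have -> : b^-1 * a^-1 * (x * y) = (a^-1 * x) ^ b * (b^-1 * y).
  by rewrite /conjg !mulgA mulgK.
by apply: sgM; [apply: nsg_conj|]; apply: coset_reprP.
Qed.

Lemma coset_invE x : quotient_inv (cosetg x) = cosetg x^-1.
Proof.
apply/cosetP; rewrite invgK; set a := coset_repr _.
have -> : a * x^-1 = ((a^-1 * x)^-1) ^ a^-1.
  by rewrite /conjg invgM !invgK !mulgA mulgK.
by apply/nsg_conj/sgV/coset_reprP.
Qed.

Lemma quotient_mulA : associative quotient_mul.
Proof.
by do 3!elim/coset_ind=> ?; rewrite !coset_mulE mulgA.
Qed.
Lemma quotient_mul1 : left_id (cosetg 1) quotient_mul.
Proof. by elim/coset_ind=> ?; rewrite !coset_mulE mul1g. Qed.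
Lemma quotient_1mul : right_id (cosetg 1) quotient_mul.
Proof. by elim/coset_ind=> ?; rewrite !coset_mulE mulg1. Qed.
Lemma quotient_mulV : left_inverse (cosetg 1) quotient_inv quotient_mul.
Proof. by elim/coset_ind=> ?; rewrite coset_invE coset_mulE mulVg. Qed.
Lemma quotient_Vmul : right_inverse (cosetg 1) quotient_inv quotient_mul.
Proof. by elim/coset_ind=> ?; rewrite coset_invE coset_mulE mulgV. Qed.

HB.instance Definition _ := isGroup.Build quotient_group quotient_mulA
  quotient_mul1 quotient_1mul quotient_mulV quotient_Vmul.

Lemma coset_monoid_morphism : monoid_morphism cosetg.
Proof. by split=> // x y; rewrite -coset_mulE. Qed.
HB.instance Definition _ :=
  isUMagmaMorphism.Build G quotient_group cosetg coset_monoid_morphism.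

Lemma coset1P x : cosetg x = 1 <-> N x.
Proof.
have -> : 1 = cosetg 1 by [].
rewrite cosetP mulg1; split=> [/sgV|/sgV//]; by rewrite invgK.
Qed.

Variables (H : groupType) (f : {hom G -> H}) (Nf : N `<=` kernel_sg f).

Definition quotient_lift (q : quotient_group) : H := f (coset_repr q).

Lemma quotient_liftE x : quotient_lift (cosetg x) = f x.
Proof.
have /Nf /= := coset_reprP x; rewrite gmulfM gmulfV => /(canRL (mulVKg _)).
by rewrite mulg1 => ->.
Qed.

Lemma quotient_lift_monoid_morphism : monoid_morphism quotient_lift.
Proof.
split; first exact: etrans (quotient_liftE 1) gmulf1.
elim/coset_ind=> x; elim/coset_ind=> y.
by rewrite -gmulfM !quotient_liftE gmulfM.
Qed.

Definition quotient_hom : {hom quotient_group -> H} :=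
  HB.pack quotient_lift
    (isUMagmaMorphism.Build _ _ quotient_lift quotient_lift_monoid_morphism).

Lemma quotient_homE x : quotient_hom (cosetg x) = f x.
Proof. exact: quotient_liftE. Qed.

End Quotient.

(* A letter [(x, true)] stands for the generator x, [(x, false)] for its
   inverse. *)
Definition word (X : Type) := seq (X * bool).

Inductive free_equiv (X : Type) : word X -> word X -> Prop :=
| free_equiv_refl u : free_equiv u u
| free_equiv_sym u v : free_equiv u v -> free_equiv v u
| free_equiv_trans u v w :
    free_equiv u v -> free_equiv v w -> free_equiv u w
| free_equiv_cancel u v x b :
    free_equiv (u ++ [:: (x, b); (x, ~~ b)] ++ v) (u ++ v).

Section FreeGroup.
Variable X : Type.
Implicit Types u v w : word X.

Lemma free_equiv_cat u u' v v' :
  free_equiv u u' -> free_equiv v v' -> free_equiv (u ++ v) (u' ++ v').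
Proof.
move=> uu' vv'; apply: (@free_equiv_trans _ _ (u ++ v')).
  elim: vv' => {v v' uu'} [v|v v' _|v v' v'' _ h1 _ h2|a b x c].
  - exact: free_equiv_refl.
  - exact: free_equiv_sym.
  - exact: free_equiv_trans h1 h2.
  - by rewrite !(catA u); apply: free_equiv_cancel.
elim: uu' => {v u u' vv'} [v|v w _|v v1 v2 _ h1 _ h2|a b x c].
- exact: free_equiv_refl.
- exact: free_equiv_sym.
- exact: free_equiv_trans h1 h2.
- by rewrite -!catA; apply: free_equiv_cancel.
Qed.

Definition free_rel (u v : {classic word X}) : bool := `[< free_equiv u v >].

Lemma free_rel_refl : reflexive free_rel.
Proof. by move=> x; apply/asboolP; apply: free_equiv_refl. Qed.
Lemma free_rel_sym : symmetric free_rel.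
Proof. by move=> x y; apply/asbool_equiv_eq; split; apply: free_equiv_sym. Qed.
Lemma free_rel_trans : transitive free_rel.
Proof.
move=> y x z /asboolP xy /asboolP yz; apply/asboolP.
exact: free_equiv_trans xy yz.
Qed.

Canonical free_rel_equiv :=
  EquivRel free_rel free_rel_refl free_rel_sym free_rel_trans.

Definition free_group : Type := {eq_quot free_rel}.
HB.instance Definition _ := Choice.on free_group.

Definition word_class (u : word X) : free_group :=
  \pi_({eq_quot free_rel}) (u : {classic word X}).
Definition word_repr (q : free_group) : word X := repr (q : {eq_quot free_rel}).

Lemma word_reprK q : word_class (word_repr q) = q.
Proof. exact: reprK. Qed.

Lemma word_classP u v : word_class u = word_class v <-> free_equiv u v.
Proof.
split=> [/eqquotP/asboolP//|uv]; apply/eqquotP; exact/asboolP.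
Qed.

Lemma word_class_ind (P : free_group -> Prop) :
  (forall u, P (word_class u)) -> forall q, P q.
Proof. by move=> Pc q; rewrite -[q]word_reprK; apply: Pc. Qed.

Lemma word_reprP u : free_equiv (word_repr (word_class u)) u.
Proof. by apply/word_classP; rewrite word_reprK. Qed.

Definition word_inv (u : word X) : word X :=
  rev [seq (a.1, ~~ a.2) | a <- u].

Lemma word_invK : involutive word_inv.
Proof.
move=> u; rewrite /word_inv map_rev revK -map_comp -[RHS]map_id.
by apply: eq_map => -[x b] /=; rewrite negbK.
Qed.

Lemma word_mulV u : free_equiv (u ++ word_inv u) [::].
Proof.
elim/last_ind: u => [|u [x b] IH]; first exact: free_equiv_refl.
rewrite /word_inv map_rcons rev_rcons -cats1 -catA /=.
by apply: free_equiv_trans IH; apply: free_equiv_cancel.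
Qed.

Lemma word_Vmul u : free_equiv (word_inv u ++ u) [::].
Proof. by have := word_mulV (word_inv u); rewrite word_invK. Qed.

Definition free_mul (p q : free_group) :=
  word_class (word_repr p ++ word_repr q).
Definition free_inv (p : free_group) := word_class (word_inv (word_repr p)).

Lemma free_mulE u v :
  free_mul (word_class u) (word_class v) = word_class (u ++ v).
Proof. by apply/word_classP/free_equiv_cat; apply: word_reprP. Qed.

Lemma free_mulA : associative free_mul.
Proof. by do 3!elim/word_class_ind=> ?; rewrite !free_mulE catA. Qed.
Lemma free_mul1 : left_id (word_class [::]) free_mul.
Proof. by elim/word_class_ind=> ?; rewrite free_mulE. Qed.
Lemma free_1mul : right_id (word_class [::]) free_mul.
Proof. by elim/word_class_ind=> ?; rewrite free_mulE cats0. Qed.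
Lemma free_mulV : left_inverse (word_class [::]) free_inv free_mul.
Proof.
move=> q; rewrite -[X in free_mul _ X]word_reprK free_mulE.
exact/word_classP/word_Vmul.
Qed.
Lemma free_Vmul : right_inverse (word_class [::]) free_inv free_mul.
Proof.
move=> q; rewrite -[X in free_mul X]word_reprK free_mulE.
exact/word_classP/word_mulV.
Qed.

HB.instance Definition _ := isGroup.Build free_group free_mulA
  free_mul1 free_1mul free_mulV free_Vmul.

Definition free_gen (x : X) : free_group := word_class [:: (x, true)].

Lemma word_classM u v :
  word_class (u ++ v) = (word_class u : free_group) * word_class v.
Proof. by rewrite -free_mulE. Qed.

Lemma word_class_cons x b u :
  word_class ((x, b) :: u) =
    (if b then free_gen x else (free_gen x)^-1) * word_class u.
Proof.
rewrite -cat1s word_classM; congr (_ * _); case: b => //.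
have h : word_class [:: (x, false)] * free_gen x = 1.
  by rewrite -word_classM; apply/word_classP/(@free_equiv_cancel _ [::] [::]).
by rewrite -(mul1g (free_gen x)^-1) -h mulgK.
Qed.

Lemma free_group_ind (P : free_group -> Prop) :
  P 1 -> (forall x q, P q -> P (free_gen x * q)) ->
  (forall x q, P q -> P ((free_gen x)^-1 * q)) -> forall q, P q.
Proof.
move=> P1 Pg PV; elim/word_class_ind; elim=> [//|[x []] u IH].
  by rewrite word_class_cons; apply: Pg.
by rewrite word_class_cons; apply: PV.
Qed.

Section Lift.
Variables (G : groupType) (f : X -> G).

Definition word_eval (u : word X) : G :=
  foldr (fun a g => (if a.2 then f a.1 else (f a.1)^-1) * g) 1 u.

Lemma word_eval_cat u v : word_eval (u ++ v) = word_eval u * word_eval v.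
Proof. by elim: u => [|a u IH] /=; rewrite ?mul1g // IH mulgA. Qed.

Lemma word_eval_equiv u v : free_equiv u v -> word_eval u = word_eval v.
Proof.
elim=> {u v} [//|u v _ -> //|u v w _ -> _ -> //|u v x b].
by rewrite !word_eval_cat /=; case: b => /=; rewrite mulg1 ?mulgV ?mulVg mul1g.
Qed.

Definition free_lift (q : free_group) : G := word_eval (word_repr q).

Lemma free_lift_class u : free_lift (word_class u) = word_eval u.
Proof. exact/word_eval_equiv/word_reprP. Qed.

Lemma free_lift_monoid_morphism : monoid_morphism free_lift.
Proof.
split; first exact: (free_lift_class [::]).
elim/word_class_ind=> u; elim/word_class_ind=> v.
by rewrite -word_classM !free_lift_class word_eval_cat.
Qed.

Definition free_hom : {hom free_group -> G} :=
  HB.pack free_lift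
    (isUMagmaMorphism.Build _ _ free_lift free_lift_monoid_morphism).

Lemma free_homE x : free_hom (free_gen x) = f x.
Proof. by rewrite [LHS]free_lift_class /= mulg1. Qed.

Lemma free_hom_unique (g : {hom free_group -> G}) :
  (forall x, g (free_gen x) = f x) -> g =1 free_hom.
Proof.
move=> gf; elim/free_group_ind => [|x q IH|x q IH]; first by rewrite !gmulf1.
  by rewrite !gmulfM IH gf free_homE.
by rewrite !gmulfM !gmulfV IH gf free_homE.
Qed.

End Lift.
End FreeGroup.

Section DirectProduct.
Variables (I : Type) (G : I -> groupType).

Definition full_product : Type := forall i, G i.
HB.instance Definition _ := gen_eqMixin full_product.
HB.instance Definition _ := gen_choiceMixin full_product.

Definition full_one : full_product := fun i => 1.
Definition full_mul (f g : full_product) : full_product := fun i => f i * g i.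
Definition full_inv (f : full_product) : full_product := fun i => (f i)^-1.

Lemma full_mulA : associative full_mul.
Proof.
by move=> f g h; apply: functional_extensionality_dep => i; apply: mulgA.
Qed.
Lemma full_mul1 : left_id full_one full_mul.
Proof.
by move=> f; apply: functional_extensionality_dep => i; apply: mul1g.
Qed.
Lemma full_1mul : right_id full_one full_mul.
Proof.
by move=> f; apply: functional_extensionality_dep => i; apply: mulg1.
Qed.
Lemma full_mulV : left_inverse full_one full_inv full_mul.
Proof.
by move=> f; apply: functional_extensionality_dep => i; apply: mulVg.
Qed.
Lemma full_Vmul : right_inverse full_one full_inv full_mul.
Proof.
by move=> f; apply: functional_extensionality_dep => i; apply: mulgV.
Qed.

HB.instance Definition _ := isGroup.Build full_product full_mulA
  full_mul1 full_1mul full_mulV full_Vmul.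

Definition finite_support : set full_product :=
  [set f | finite_set [set i | f i <> 1]].

Lemma finite_support_closed : group_closed [in finite_support].
Proof.
apply: group_closedP => [|f g Ff Fg|f Ff].
- rewrite /finite_support /=.
  suff -> : [set i | (1 : full_product) i <> 1] = set0.
    exact: finite_set0.
  by apply/seteqP; split=> i.
- have Ffg : finite_set ([set i | f i <> 1] `|` [set i | g i <> 1]).
    by rewrite finite_setU.
  apply: sub_finite_set Ffg => i /= fgi.
  have [fi|fi] := EM (f i = 1); [right => gi|by left].
  by apply: fgi; rewrite /mul /= /full_mul fi gi mulg1.
- apply: sub_finite_set Ff => i /= fi f1; apply: fi.
  by rewrite /inv /= /full_inv f1 invg1.
Qed.

Definition direct_product : groupType :=
  subgroup_of (Subgroup finite_support_closed).

Section Injection.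
Variable i : I.

Definition single (x : G i) : full_product := fun j =>
  if pselect (i = j) is left e then eq_rect i G x j e else 1.

Lemma single_finite_support (x : G i) : finite_support (single x).
Proof.
apply: (@sub_finite_set _ _ [set i]); last exact: finite_set1.
by move=> j /=; rewrite /single; case: pselect.
Qed.

Definition direct_in (x : G i) : direct_product :=
  exist _ (single x) (mem_set (single_finite_support x)).

Lemma direct_in_monoid_morphism : monoid_morphism direct_in.
Proof.
split=> [|x y]; apply/val_inj/functional_extensionality_dep => j;
  rewrite /= /single; case: pselect => // e.
- by case: _ / e.
- rewrite /mul /= /full_mul /=; case: pselect => // e'.
  by rewrite (Prop_irrelevance e' e); case: _ / e.
- by rewrite /mul /= /full_mul /=; case: pselect => // _; rewrite mulg1.
Qed.

Definition direct_in_hom : {hom G i -> direct_product} :=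
  HB.pack direct_in
    (isUMagmaMorphism.Build _ _ direct_in direct_in_monoid_morphism).

End Injection.
End DirectProduct.

Section FreeProduct.
Variables (I : Type) (G : I -> groupType).

Let letter := {i : I & G i}.
Let gen (i : I) (x : G i) : free_group letter :=
  free_gen (existT G i x : letter).

Definition free_product_relators : set (free_group letter) :=
  [set r | exists i (x y : G i), r = gen x * gen y * (gen (x * y))^-1].

Definition free_product : groupType :=
  quotient_group (normal_closure free_product_relators).

Definition free_in (i : I) (x : G i) : free_product := cosetg _ (gen x).

Lemma free_in_monoid_morphism i : monoid_morphism (@free_in i).
Proof.
have M x y : @free_in i (x * y) = free_in x * free_in y.
  rewrite /free_in -gmulfM; symmetry; apply/divg1_eq.
  rewrite -gmulfF; apply/coset1P/sub_generated.
  exists (gen x * gen y * (gen (x * y))^-1), 1.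
  by rewrite conjg1; split => //; exists i, x, y.
split=> //; apply: (@mulgI free_product (free_in (1 : G i))).
by rewrite [RHS]mulg1 -[LHS]M [X in free_in X]mulg1.
Qed.

Definition free_in_hom i : {hom G i -> free_product} :=
  HB.pack (@free_in i)
    (isUMagmaMorphism.Build _ _ (@free_in i) (free_in_monoid_morphism i)).

Section Lift.
Variables (H : groupType) (f : forall i, {hom G i -> H}).

Let f' : {hom free_group letter -> H} :=
  free_hom (fun a : letter => f (projT1 a) (projT2 a)).

Lemma free_product_relators_sub :
  normal_closure free_product_relators `<=` kernel_sg f'.
Proof.
apply: normal_closure_min => _ [i [x [y ->]]].
change (f' (gen x * gen y * (gen (x * y))^-1) = 1).
by rewrite gmulfF gmulfM !free_homE /= gmulfM mulgV.
Qed.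

Definition free_product_hom : {hom free_product -> H} :=
  quotient_hom free_product_relators_sub.

Lemma free_product_homE i x : free_product_hom (free_in_hom i x) = f i x.
Proof.
exact: etrans (quotient_homE free_product_relators_sub _) (free_homE _ _).
Qed.

Lemma free_product_hom_unique (g : {hom free_product -> H}) :
  (forall i x, g (free_in_hom i x) = f i x) -> g =1 free_product_hom.
Proof.
move=> gf; elim/coset_ind => q; rewrite [RHS]quotient_homE.
by apply: (free_hom_unique (g := g \o @cosetg _ _)) => -[i x]; apply: gf.
Qed.

End Lift.

(* The natural epimorphism; its kernel is the normal closure of the [G_i, G_j],
   i <> j. *)
Definition free_to_direct : {hom free_product -> direct_product G} :=
  free_product_hom (@direct_in_hom I G).

Definition second_nilpotent_product : groupType :=
  quotient_group (sgI (gamma3 free_product) (kernel_sg free_to_direct)).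

End FreeProduct.

Section Hopf.
Variables (G : groupType) (X : Type) (p : {hom free_group X -> G}).

Let F := free_group X.
Let R : nsubgroup F := kernel_sg p.
Let RF' : nsubgroup F := sgI R (derived_sg F).

(* (R /\ F') / [R, F], for R the kernel of p. *)
Definition hopf_group : groupType :=
  quotient_group (preim_sg (@subgroup_incl F RF') (commutator_sg R (whole F))).

End Hopf.

Section HopfMap.
Variables (G : groupType).

Lemma commutator_map (E F : groupType) (f : {hom E -> F})
    (H K : nsubgroup E) (H' K' : nsubgroup F) :
  (forall x, H x -> H' (f x)) -> (forall x, K x -> K' (f x)) ->
  forall x, commutator_sg H K x -> commutator_sg H' K' (f x).
Proof.
move=> fH fK x /(_ (preim_sg f (commutator_sg H' K'))); apply.
move=> _ [h [k [Hh Kk ->]]]; rewrite /sg_set /= /preimage /= gmulfR.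
apply: sub_generated; exists (f h), (f k).
by split => //; [apply: fH|apply: fK].
Qed.

Section Map.
Variables (X Y : Type).
Variables (p : {hom free_group X -> G}) (q : {hom free_group Y -> G}).
Variables (f : {hom free_group X -> free_group Y}).
Hypothesis qf : forall u, q (f u) = p u.

Let S : nsubgroup (free_group X) :=
  sgI (kernel_sg p) (derived_sg (free_group X)).
Let T : nsubgroup (free_group Y) :=
  sgI (kernel_sg q) (derived_sg (free_group Y)).

Lemma hopf_sub u : S u -> T (f u).
Proof.
move=> [pu du]; split; first by rewrite /= -pu; apply: qf.
exact: commutator_map du.
Qed.

Definition hopf_restrict (u : subgroup_of S) : subgroup_of T :=
  exist _ (f (val u)) (mem_set (hopf_sub (set_mem (valP u)))).

Lemma hopf_restrict_monoid_morphism : monoid_morphism hopf_restrict.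
Proof.
by split=> [|u v]; apply: val_inj; rewrite /= ?gmulf1 ?gmulfM.
Qed.

Definition hopf_restrict_hom : {hom subgroup_of S -> subgroup_of T} :=
  HB.pack hopf_restrict
    (isUMagmaMorphism.Build _ _ hopf_restrict hopf_restrict_monoid_morphism).

Let coset_T : {hom subgroup_of T -> hopf_group q} := @cosetg _ _.
Let hopf_to : {hom subgroup_of S -> hopf_group q} :=
  coset_T \o hopf_restrict_hom.

Lemma hopf_to_kernel :
  preim_sg (@subgroup_incl _ S) (commutator_sg (kernel_sg p) (whole _)) `<=`
  kernel_sg hopf_to.
Proof.
move=> u cu; apply/coset1P.
apply: (commutator_map (f := f)) cu => // x px.
by rewrite /= -px; apply: qf.
Qed.

Definition hopf_map : {hom hopf_group p -> hopf_group q} :=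
  quotient_hom hopf_to_kernel.

Lemma hopf_mapE u : hopf_map (cosetg _ u) = cosetg _ (hopf_restrict u).
Proof. exact: quotient_homE. Qed.

End Map.

Lemma hopf_endo (X : Type) (p : {hom free_group X -> G})
    (t : {hom free_group X -> free_group X}) :
  (forall u, p (t u) = p u) -> forall u, derived_sg _ u ->
  commutator_sg (kernel_sg p) (whole _) (u^-1 * t u).
Proof.
move=> pt; set N := commutator_sg _ _.
have Rt u : kernel_sg p (u^-1 * t u) by rewrite /= gmulfM gmulfV pt mulVg.
pose d u := cosetg N (u^-1 * t u).
have dC u (z : quotient_group N) : commute (d u) z.
  elim/coset_ind: z => z; apply/commgP/eqP.
  rewrite -[LHS](gmulfR (cosetg N : {hom _ -> _})).
  by apply/coset1P/sub_generated; exists (u^-1 * t u), z.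
have dM : monoid_morphism d.
  split; first by rewrite /d gmulf1 mulVg.
  move=> u v; have -> : d (u * v) = cosetg N (v^-1 * (u^-1 * t u) * t v).
    by rewrite /d (gmulfM (s := t)) invgM !mulgA.
  rewrite 2!gmulfM -/(d u) -(dC u (cosetg N v^-1)) -mulgA; congr (_ * _).
  by rewrite -gmulfM.
pose dh : {hom free_group X -> quotient_group N} :=
  HB.pack d (isUMagmaMorphism.Build _ _ d dM).
move=> u /(_ (kernel_sg dh)) du; apply/coset1P; apply: du.
move=> _ [h [k [_ _ ->]]]; rewrite /sg_set /= -[d]/(dh : _ -> _).
by rewrite gmulfR; apply/eqP/commgP/dC.
Qed.

Lemma hopf_mapK (X Y : Type) (p : {hom free_group X -> G})
    (q : {hom free_group Y -> G})
    (f : {hom free_group X -> free_group Y})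
    (g : {hom free_group Y -> free_group X})
    (qf : forall u, q (f u) = p u) (pg : forall u, p (g u) = q u) :
  cancel (hopf_map qf) (hopf_map pg).
Proof.
elim/coset_ind=> u; rewrite !hopf_mapE; apply/esym/cosetP.
have [_ du] := set_mem (valP u).
by apply: (hopf_endo (t := g \o f)) du => v /=; rewrite pg qf.
Qed.

Lemma free_projective (X Y : Type) (p : {hom free_group X -> G})
    (q : {hom free_group Y -> G}) : (forall g, exists v, q v = g) ->
  exists f : {hom free_group X -> free_group Y}, forall u, q (f u) = p u.
Proof.
move=> qs; pose s x := sval (cid (qs (p (free_gen x)))).
have qs' x : q (s x) = p (free_gen x) by rewrite /s; case: cid.
exists (free_hom s) => u.
rewrite (free_hom_unique (f := p \o @free_gen X) (g := p)) //.
apply: (free_hom_unique (g := q \o free_hom s)) => x.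
exact: etrans (congr1 q (free_homE s x)) (qs' x).
Qed.

Lemma hopf_group_indep (X Y : Type) (p : {hom free_group X -> G})
    (q : {hom free_group Y -> G}) :
  (forall g, exists u, p u = g) -> (forall g, exists v, q v = g) ->
  isomorphic (hopf_group p) (hopf_group q).
Proof.
move=> ps qs.
have [f qf] := free_projective p qs; have [g pg] := free_projective q ps.
by exists (hopf_map qf), (hopf_map pg); apply: hopf_mapK.
Qed.

End HopfMap.

(* The Schur multiplier, computed from the presentation of G with all its
   elements as generators.  By [schur_multiplier_indep] any other free
   presentation gives an isomorphic group. *)
Definition schur_multiplier (G : groupType) : groupType :=
  hopf_group (free_hom (@idfun G)).

Lemma schur_multiplier_indep (G : groupType) (X : Type)
    (p : {hom free_group X -> G}) :
  (forall g, exists u, p u = g) ->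
  isomorphic (schur_multiplier G) (hopf_group p).
Proof.
move=> ps; apply: hopf_group_indep => // g.
by exists (free_gen g); rewrite free_homE.
Qed.

Definition is_covering_group (Gs G : groupType) : Prop :=
  exists A : nsubgroup Gs,
    [/\ isomorphic (quotient_group A) G,
        A `<=` center_sg Gs `&` derived_sg Gs
      & isomorphic (subgroup_of A) (schur_multiplier G)].

(* Main.v *)
Require Import Defs.
From HB Require Import structures.
From mathcomp Require Import all_boot fingroup cyclic.
From mathcomp Require Import boolp classical_sets cardinality.

(** Let S_i be the covering group of A_i, F_i the free group on S_i with kernel
    R_i over A_i, F the free product of the F_i, P that of the S_i, and R the
    kernel of F over G = prod A_i.  A comparison map from the multiplier of A_i
    onto the central kernel of S_i is a surjection between isomorphic groups,
    which are finite by Schur's theorem (a central-by-finite group has a finite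
    derived subgroup), so it is injective: u in F_i' that dies in S_i lies in
    [R_i, F_i].

    The kernel of the second nilpotent product over G is central and contained
    in the derived subgroup, so (R /\ F') / [R, F] maps onto it, and it remains
    to see that u in F' that dies in the second nilpotent product lies in
    [R, F].  Modulo [R, F], the preimage of S_i' in F_i commutes with F_j for
    j <> i; the subgroup generated by these preimages and [R, F] is normal and
    its quotient has class at most 2, so it contains u, because the image of u
    in P is in gamma_3(P).  Hence u is, modulo [R, F], the product of its
    coordinates in the F_i.  These are in F_i' and die in S_i, because the image
    of u in prod S_i is trivial, so they are in [R_i, F_i]. *)

Set Implicit Arguments.
Unset Strict Implicit.
Unset Printing Implicit Defensive.

Local Open Scope group_scope.

(** * Finite sets and counting *)

Lemma inj_surj_bijective (S T : Type) (f : S -> T) :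
  injective f -> (forall y, exists x, f x = y) -> bijective f.
Proof.
move=> fI fS; pose g y := sval (cid (fS y)).
have gK y : f (g y) = y by rewrite /g; case: cid.
by exists g => // x; apply/fI/gK.
Qed.

(** [j] makes [T] finite. A section [g] of [f] is injective, hence by counting onto, so [f] is its
    two-sided inverse. *)
Lemma finite_surj_inj (T : choiceType) (S : eqType) (j : T -> S) (s : seq S)
    (f : T -> T) :
  injective j -> (forall x, j x \in s) -> (forall y, exists x, f x = y) ->
  injective f.
Proof.
move=> jI js fS; pose g y := sval (cid (fS y)).
have gK y : f (g y) = y by rewrite /g; case: cid.
have gI : injective g by apply: can_inj gK.
have [r rT] : exists r : seq T, forall x, x \in r.
  pose h y : option T := if pselect (exists x, j x = y) is left e
    then Some (sval (cid e)) else None.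
  exists (pmap h s) => x; rewrite mem_pmap; apply/mapP; exists (j x) => //.
  rewrite /h; case: pselect => [e|[]]; last by exists x.
  by congr Some; apply/jI; case: cid.
have gS x : exists y, g y = x.
  have [//|||_ sub] := @uniq_min_size _ [seq g y | y <- undup r] (undup r).
  - by rewrite (map_inj_uniq gI) undup_uniq.
  - by move=> y _; rewrite mem_undup.
  - by rewrite size_map.
  have := sub x; rewrite mem_undup rT => /mapP[y _ ->]; by exists y.
by move=> x y; have [x' <-] := gS x; have [y' <-] := gS y; rewrite !gK => ->.
Qed.

(** Pigeonhole principle: each entry of [c] accounts for at most [n] entries of [l]. *)
Lemma size_count_leq (T : eqType) (n : nat) (c l : seq T) :
  {subset l <= c} -> (forall z, z \in l -> ~~ (n < count_mem z l))%N ->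
  (size l <= n * size c)%N.
Proof.
elim: c l => [|a c IH] l lc small.
  by case: l lc {small} => // z l /(_ z (mem_head z l)).
rewrite -(count_predC (pred1 a) l) mulnS; apply: leq_add.
  have [/small|al] := boolP (a \in l); first by rewrite -leqNgt.
  by rewrite (count_memPn al).
rewrite -size_filter; apply: IH => z; rewrite mem_filter => /andP[/= za zl].
  by have := lc z zl; rewrite inE (negPf za).
apply: contra (small z zl) => /leq_trans; apply.
by rewrite count_filter; apply: sub_count => x /andP[].
Qed.

(** * Centers, commutators and derived subgroups *)

Lemma center_closed (G : groupType) : group_closed [in center_sg G].
Proof.
apply: group_closedP => [y|x y Zx Zy z|x Zx z].
- exact/commute_sym/commute1.
- by apply/commute_sym/commuteM; apply/commute_sym.
- exact/commute_sym/commuteV/commute_sym.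
Qed.

Lemma center_conj (G : groupType) (x y : G) :
  center_sg G x -> center_sg G (x ^ y).
Proof. by move=> Zx; have -> : x ^ y = x by rewrite /conjg Zx mulKg. Qed.

Definition center_nsg (G : groupType) : nsubgroup G :=
  @NSubgroup G (Subgroup (center_closed G)) (@center_conj G).

Lemma commMgJ (G : groupType) (x y z : G) :
  [~ x * y, z] = [~ x, z] ^ y * [~ y, z].
Proof. by rewrite !commgEr conjgM mulgA -conjMg mulgK. Qed.

Lemma commg_center (G : groupType) (x y u v : G) :
  center_sg G u -> center_sg G v -> [~ x * u, y * v] = [~ x, y].
Proof.
move=> Zu Zv.
have Zl a b w : center_sg G w -> [~ a * w, b] = [~ a, b].
  move=> Zw; rewrite commMgJ /conjg -(Zw [~ a, b]) mulKg.
  by have /commgP/eqP -> := Zw b; rewrite mulg1.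
by rewrite Zl // -invgR Zl // invgR.
Qed.

Section Morphisms.
Variables (G H : groupType) (f : {hom G -> H}).

Lemma image_closed (K : subgroup G) :
  group_closed [in [set y | exists2 x, K x & f x = y]%classic].
Proof.
apply: group_closedP => [|_ _ [x Kx <-] [y Ky <-]|_ [x Kx <-]].
- by exists 1; [apply: sg1|apply: gmulf1].
- by exists (x * y); [apply: sgM|apply: gmulfM].
- by exists x^-1; [apply: sgV|apply: gmulfV].
Qed.

Definition image_sg (K : subgroup G) : subgroup H :=
  Subgroup (image_closed K).

Lemma derived_map x : derived_sg G x -> derived_sg H (f x).
Proof. exact: commutator_map. Qed.

Hypothesis fS : forall y, exists x, f x = y.

Lemma derived_surj y :
  derived_sg H y -> exists2 x, derived_sg G x & f x = y.
Proof.
move=> /(_ (image_sg (derived_sg G))); apply => _ [h [k [_ _ ->]]].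
have [x <-] := fS h; have [z <-] := fS k.
exists [~ x, z]; last exact: gmulfR.
by apply: sub_generated; exists x, z.
Qed.

End Morphisms.

Lemma commutator_min (G : groupType) (H K : nsubgroup G) (N : subgroup G) :
  (forall h k, H h -> K k -> N [~ h, k]) ->
  forall x, commutator_sg H K x -> N x.
Proof.
by move=> NR x /(_ N); apply => _ [h [k [Hh Kk ->]]]; apply: NR.
Qed.

Lemma derived_min (G : groupType) (N : subgroup G) :
  (forall x y, N [~ x, y]) -> forall x, derived_sg G x -> N x.
Proof. by move=> NR; apply: commutator_min => h k _ _; apply: NR. Qed.

(* If f(E) and y commute modulo the center then x |-> [f x, y] is a morphism to
   an abelian group, so it kills E'. *)
Lemma derived_commute (E U : groupType) (f : {hom E -> U}) (y : U) :
  (forall x, center_sg U [~ f x, y]) ->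
  forall x, derived_sg E x -> commute (f x) y.
Proof.
move=> Zf.
have hM : monoid_morphism (fun x => [~ f x, y]).
  split=> [|x z]; first by rewrite gmulf1 comm1g.
  by rewrite gmulfM commMgJ /conjg Zf mulKg.
pose h : {hom E -> U} :=
  HB.pack (fun x => [~ f x, y]) (isUMagmaMorphism.Build _ _ _ hM).
move=> x Ex; apply/commgP/eqP.
apply: (derived_min (N := kernel_sg h)) Ex => a b.
by change (h [~ a, b] = 1); rewrite gmulfR; apply/eqP/commgP/Zf.
Qed.

(** * Schur's theorem on central-by-finite groups *)

Section CentralByFinite.
Variables (E : groupType) (A : finGroupType) (f : {hom E -> A}).
Hypothesis fZ : forall x, f x = 1 -> center_sg E x.

Let comms (l : seq E) := forall z, z \in l -> exists x y, z = [~ x, y].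

Let comms_cons z l : comms (z :: l) -> (exists x y, z = [~ x, y]) /\ comms l.
Proof.
by move=> h; split=> [|x xl]; apply: h; rewrite inE ?eqxx ?xl ?orbT.
Qed.

Let cons_comms z l : (exists x y, z = [~ x, y]) -> comms l -> comms (z :: l).
Proof. by move=> zP lP x; rewrite inE => /predU1P[->|/lP]. Qed.

Let comms_cat l1 l2 : comms l1 -> comms l2 -> comms (l1 ++ l2).
Proof. by move=> h1 h2 z; rewrite mem_cat => /orP[/h1|/h2]. Qed.

Let commX z n : (exists x y, z = [~ x, y]) -> comms (nseq n z).
Proof. by move=> zP x /nseqP[-> _]. Qed.

Lemma commutator_finite :
  exists c : seq E, forall x y : E, [~ x, y] \in c.
Proof.
(* [s] chooses preimages; its default value 1 never occurs at a point [f x]. Since [x] and [s (f x)]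
   differ by a central element, the commutators of the finitely many chosen preimages are all there
   are. *)
pose s (a : A) := if pselect (exists x, f x = a) is left e then sval (cid e)
  else 1.
have sP x : exists2 z, center_sg E z & x = s (f x) * z.
  exists ((s (f x))^-1 * x); last by rewrite mulVKg.
  apply: fZ; rewrite gmulfM gmulfV /s.
  by case: pselect => [e|[]]; [case: cid => /= z ->; rewrite mulVg|exists x].
exists [seq [~ s a, s b] | a <- enum A, b <- enum A] => x y.
apply/allpairsP; exists (f x, f y); rewrite !mem_enum; split=> //=.
have [u Zu {1}->] := sP x; have [v Zv {1}->] := sP y.
exact: commg_center.
Qed.

Let prod_nseq (z : E) n : \prod_(x <- nseq n z) x = z ^+ n.
Proof. by rewrite big_nseq iter_mulg_1. Qed.

(* With c = [x, y] and n = |A|, c^n is central, so that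
   c^(n+1) = x^-1 y^-1 x c^n y = [x, y^2] (c^y)^(n-1). *)
Lemma commutator_expg (x y : E) :
  exists l, [/\ comms l, [~ x, y] ^+ #|A|.+1 = \prod_(z <- l) z
    & size l = #|A|].
Proof.
set c := [~ x, y].
have ZX : center_sg E (c ^+ #|A|).
  apply: fZ; rewrite gmulfXn.
  have := @expg_cardG A [set: A]%G (f c) (finset.in_setT _).
  by rewrite finset.cardsT.
have /prednK nA : (0 < #|A|)%N by apply/card_gt0P; exists (1 : A).
exists ([~ x, y * y] :: nseq #|A|.-1 (c ^ y)); split.
- apply: cons_comms; first by exists x, (y * y).
  by apply: commX; exists (x ^ y), (y ^ y); rewrite -conjRg.
- have -> : c ^+ #|A|.+1 = x^-1 * y^-1 * x * c ^+ #|A| * y.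
    rewrite expgSr -(ZX (x^-1 * y^-1 * x)) -mulgA; congr (_ * _).
    by rewrite /c /commg /conjg !mulgA.
  rewrite big_cons prod_nseq -conjXg -nA expgS /= {1}/c /commg /conjg !invgM.
  by rewrite !mulgA !mulgK.
- by rewrite /= size_nseq nA.
Qed.

(** Moving a power of [z] to the left past [y] replaces [y] by a conjugate, which is again a
    commutator, so the number of factors does not change. *)
Lemma commutator_extract z l : comms l -> (exists x y, z = [~ x, y]) ->
  exists2 l', comms l' &
    \prod_(x <- l) x = z ^+ count_mem z l * \prod_(x <- l') x
    /\ size l = (count_mem z l + size l')%N.
Proof.
elim: l => [_ _|y l IH /comms_cons[yP lP] zP].
  by exists [::]; rewrite // big_nil mulg1.
have [l' l'P [e1 e2]] := IH lP zP; rewrite big_cons /= e1.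
have [->|yz] := eqVneq y z.
  by exists l' => //; rewrite expgS !mulgA add1n e2.
exists ((y ^ (z ^+ count_mem z l)) :: l').
  apply: cons_comms => //; have [a [b ->]] := yP.
  by rewrite conjRg; eexists _, _.
by rewrite big_cons add0n /= addnS e2 /conjg !mulgA mulgV mul1g.
Qed.

(* Schur's theorem.  In a product of more than |A| |c| commutators some
   commutator z occurs more than |A| times; collecting these occurrences on the
   left shortens the product, z^(|A|+1) being a product of |A| commutators. *)
Lemma derived_finite : exists s : seq E, forall x, derived_sg E x -> x \in s.
Proof.
have [c cP] := commutator_finite.
have shorten l : comms l -> exists l', [/\ comms l',
    \prod_(x <- l') x = \prod_(x <- l) x & (size l' <= #|A| * size c)%N].
  have [n] := ubnP (size l); elim: n l => // n IH l ln lP.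
  have [lc|lc] := leqP (size l) (#|A| * size c); first by exists l.
  have [z zl zA] : exists2 z, z \in l & (#|A| < count_mem z l)%N.
    apply/hasP; apply: contraTT lc => /hasPn small; rewrite -leqNgt.
    by apply: size_count_leq small => z /lP[x [y ->]].
  have [|l1 l1P [e1 s1]] := commutator_extract lP (z := z); first exact: lP.
  have [x [y zE]] := lP _ zl.
  have [l2 [l2P e2 s2]] := commutator_expg x y; rewrite -zE in e2.
  pose k := (count_mem z l - #|A|.+1)%N.
  have [||l' [l'P e' s']] := IH (l2 ++ nseq k z ++ l1).
  - rewrite ltnS in ln; rewrite !size_cat size_nseq s2.
    by apply: leq_trans ln; rewrite s1 addnA ltn_add2r -[ltnRHS](subnKC zA).
  - by apply: comms_cat => //; apply: comms_cat => //; apply/commX/lP.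
  exists l'; split=> //.
  by rewrite e' !big_cat /= prod_nseq -e2 mulgA -expgnDr subnKC // -e1.
have [S SP] : exists S : seq E, forall l, comms l ->
    (size l <= #|A| * size c)%N -> \prod_(x <- l) x \in S.
  elim: (_ * _)%N => [|n [S SP]].
    exists [:: 1] => l _; rewrite leqn0 size_eq0 => /eqP->.
    by rewrite big_nil inE.
  exists (1 :: [seq x * y | x <- c, y <- S]) => -[|z l].
    by rewrite big_nil inE eqxx.
  move=> /comms_cons[[x [y ->]] lP] ln; rewrite big_cons inE.
  by apply/orP; right; apply: allpairs_f; [apply: cP|apply: SP].
exists S => x.
have prodsM : group_closed
    [in [set x | exists2 l, comms l & x = \prod_(y <- l) y]%classic].
  apply: group_closedP => [|_ _ [l lP ->] [l' l'P ->]|_ [l lP ->]].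
  - by exists [::]; rewrite ?big_nil.
  - by exists (l ++ l'); [apply: comms_cat|rewrite big_cat].
  exists [seq y^-1 | y <- rev l]; last by rewrite big_map prodgV revK.
  move=> _ /mapP[y + ->]; rewrite mem_rev => /lP[a [b ->]].
  by exists b, a; rewrite invgR.
move=> /(derived_min (N := Subgroup prodsM))[] => [a b|l lP ->].
  exists [:: [~ a, b]]; last by rewrite big_seq1.
  by apply: cons_comms => //; exists a, b.
by have [l' [l'P <- l'c]] := shorten l lP; apply: SP.
Qed.

End CentralByFinite.

(** * Comparison of the Hopf quotient with a central kernel *)

Lemma commutator_whole_center (G : groupType) (N : nsubgroup G) x y :
  N x -> commute (cosetg (commutator_sg N (whole G)) x) y.
Proof.
move=> Nx; elim/coset_ind: y => y; apply/commgP/eqP; rewrite -gmulfR.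
by apply/coset1P/sub_generated; exists x, y.
Qed.

Lemma isomorphic_sym (G H : groupType) : isomorphic G H -> isomorphic H G.
Proof.
move=> [f [g fK gK]].
have gM : monoid_morphism g.
  by split; [apply: can2_gmulf1 fK gK|apply: can2_gmulfM fK gK].
exists (HB.pack g (isUMagmaMorphism.Build _ _ g gM) : {hom _ -> _}).
by exists f.
Qed.

Lemma isomorphic_trans (G H K : groupType) :
  isomorphic G H -> isomorphic H K -> isomorphic G K.
Proof. by move=> [f fB] [g gB]; exists (g \o f); apply: bij_comp. Qed.

Section HopfComparison.
Variables (G E : groupType) (X : Type).
Variables (p : {hom free_group X -> G}) (q : {hom free_group X -> E}).
Variables (c : {hom E -> G}) (B : nsubgroup E).
Hypothesis cq : forall u, c (q u) = p u.
Hypothesis qS : forall x, exists u, q u = x.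
Hypothesis Bc : forall x, B x <-> c x = 1.
Hypothesis BZ : forall x, B x -> center_sg E x.
Hypothesis BE' : forall x, B x -> derived_sg E x.

Let F := free_group X.
Let RF : nsubgroup F := commutator_sg (kernel_sg p) (whole F).
Let S : nsubgroup F := sgI (kernel_sg p) (derived_sg F).

(** [q] maps R into the central subgroup [B], so it kills [R, F]. It is onto [B] because an element
    of [B], being in E', lifts to F', and any lift lies in R. *)
Lemma hopf_comparison : exists t : {hom hopf_group p -> subgroup_of B},
  (forall b, exists h, t h = b) /\
  (forall u : subgroup_of S, val (t (cosetg _ u)) = q (val u)).
Proof.
have qB (u : subgroup_of S) : B (q (val u)).
  by apply/Bc; rewrite cq; have [] := set_mem (valP u).
pose t0 u : subgroup_of B := exist _ (q (val u)) (mem_set (qB u)).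
have t0M : monoid_morphism t0.
  by split=> [|u v]; apply: val_inj; rewrite /= ?gmulf1 ?gmulfM.
pose t1 : {hom subgroup_of S -> subgroup_of B} :=
  HB.pack t0 (isUMagmaMorphism.Build _ _ _ t0M).
have t1K : (preim_sg (@subgroup_incl F S) RF `<=` kernel_sg t1)%classic.
  move=> u RFu; apply: val_inj => /=.
  apply: (commutator_min (N := kernel_sg q)) RFu => h k ph _.
  change (q [~ h, k] = 1); rewrite gmulfR; apply/eqP/commgP/BZ/Bc.
  by rewrite cq.
exists (quotient_hom t1K); split=> [b|u]; last by rewrite quotient_homE.
have Bb : B (val b) by apply: set_mem (valP b).
have [u u' qu] := derived_surj qS (BE' Bb).
have Su : S u by split=> //=; rewrite -cq qu; apply/Bc.
exists (cosetg _ (exist _ u (mem_set Su) : subgroup_of S)).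
by rewrite quotient_homE; apply: val_inj.
Qed.

Lemma isomorphic_hopf_group :
  (forall u, derived_sg F u -> q u = 1 -> RF u) ->
  isomorphic (subgroup_of B) (hopf_group p).
Proof.
move=> RFq; have [t [tS tE]] := hopf_comparison.
have tI : injective t.
  apply: gmulf_inj; elim/coset_ind => v tv; apply/coset1P/RFq.
    by have [] := set_mem (valP v).
  by rewrite -tE tv.
by apply: isomorphic_sym; exists t; apply: inj_surj_bijective tI tS.
Qed.

End HopfComparison.

(** F/[R, F] is central-by-finite, since R/[R, F] is central with quotient inside [A]. Its derived
    subgroup is therefore finite and contains the Hopf quotient through [j]. Thus [phi \o t] is a
    surjective self-map of a finite set, hence injective, and so is [t]. *)
Lemma hopf_comparison_inj (A : finGroupType) (E : groupType) (X : Type)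
    (p : {hom free_group X -> A}) (q : {hom free_group X -> E})
    (c : {hom E -> A}) (B : nsubgroup E) :
  (forall u, c (q u) = p u) -> (forall x, exists u, q u = x) ->
  (forall x, B x <-> c x = 1) -> (forall x, B x -> center_sg E x) ->
  (forall x, B x -> derived_sg E x) ->
  isomorphic (subgroup_of B) (hopf_group p) ->
  forall u, derived_sg _ u -> q u = 1 ->
  commutator_sg (kernel_sg p) (whole _) u.
Proof.
move=> cq qS Bc BZ BE' [phi phiB] u u' qu; set RF := commutator_sg _ _.
have [t [tS tE]] := hopf_comparison cq qS Bc BZ BE'.
pose S := sgI (kernel_sg p) (derived_sg (free_group X)).
pose j0 : {hom subgroup_of S -> quotient_group RF} :=
  cosetg RF \o @subgroup_incl _ S.
have j0K : (preim_sg (@subgroup_incl _ S) RF `<=` kernel_sg j0)%classic.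
  by move=> v RFv; apply/coset1P.
pose j : {hom hopf_group p -> quotient_group RF} := quotient_hom j0K.
have jI : injective j.
  apply: gmulf_inj; elim/coset_ind => v; rewrite quotient_homE.
  by move=> /coset1P RFv; apply/coset1P.
have pK : (RF `<=` kernel_sg p)%classic.
  apply: commutator_min => h k ph _; change (p [~ h, k] = 1).
  by rewrite gmulfR ph comm1g.
have [x|s sP] := @derived_finite _ A (quotient_hom pK).
  elim/coset_ind: x => x; rewrite quotient_homE => px.
  by move=> y; apply: (commutator_whole_center (N := kernel_sg p)).
have phitI : injective (phi \o t).
  apply: (finite_surj_inj (j := j) (s := s)) => // [h|h].
    apply: sP; elim/coset_ind: h => v; rewrite quotient_homE.
    have [_ v'] := set_mem (valP v).
    exact: (derived_map (cosetg RF) v').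
  have [psi _ psiK] := phiB; have [h' h'E] := tS (psi h).
  by exists h'; rewrite /= h'E psiK.
have Su : S u by split=> //=; rewrite -cq qu; apply: gmulf1.
pose v : subgroup_of S := exist _ u (mem_set Su).
have /coset1P : (cosetg _ v : hopf_group p) = 1.
  apply: phitI; rewrite gmulf1 /=.
  have -> : t (cosetg _ v) = 1 by apply: val_inj; rewrite tE /= qu.
  exact: gmulf1.
by [].
Qed.

(** * Free groups and coordinates in restricted direct products *)

Lemma free_commute (X : Type) (H : groupType) (f : {hom free_group X -> H}) :
  (forall x y, commute (f (free_gen x)) (f (free_gen y))) ->
  forall u v, commute (f u) (f v).
Proof.
move=> fX; have ind z : (forall x, commute z (f (free_gen x))) ->
    forall u, commute z (f u).
  move=> zX; elim/free_group_ind => [|x u zu|x u zu].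
  - by rewrite gmulf1; apply: commute1.
  - by rewrite gmulfM; apply: commuteM (zX x) zu.
  - by rewrite gmulfM gmulfV; apply: commuteM zu; apply: commuteV (zX x).
by move=> u v; apply: (ind) => y; apply/commute_sym/ind => x; apply/commute_sym.
Qed.

Lemma free_hom_eq (X : Type) (G : groupType) (f g : {hom free_group X -> G}) :
  (forall x, f (free_gen x) = g (free_gen x)) -> f =1 g.
Proof.
by move=> fg u; rewrite (free_hom_unique fg) -(free_hom_unique (g := g)).
Qed.

Section Coordinates.
Variables (I : Type) (G : I -> groupType).

Lemma single_same i (x : G i) : single x i = x.
Proof.
by rewrite /single; case: pselect => // e; rewrite (Prop_irrelevance e erefl).
Qed.

Lemma single_neq i j (x : G i) : i <> j -> single x j = 1.
Proof. by rewrite /single; case: pselect. Qed.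

Lemma coord_monoid_morphism i :
  monoid_morphism (fun x : direct_product G => val x i).
Proof. by split. Qed.

Definition coord i : {hom direct_product G -> G i} :=
  HB.pack (fun x : direct_product G => val x i)
    (isUMagmaMorphism.Build _ _ _ (coord_monoid_morphism i)).

Lemma coord_inj (x y : direct_product G) :
  (forall i, coord i x = coord i y) -> x = y.
Proof. by move=> xy; apply/val_inj/functional_extensionality_dep. Qed.

Lemma coord_direct_in i j (x : G i) :
  coord j (direct_in_hom G i x) = single x j.
Proof. by []. Qed.

Lemma direct_in_commute i j (x : G i) (y : G j) :
  i <> j -> commute (direct_in_hom G i x) (direct_in_hom G j y).
Proof.
move=> ij; apply: coord_inj => k; rewrite !gmulfM !coord_direct_in.
have [ik|ik] := pselect (i = k); last by rewrite single_neq // mul1g mulg1.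
by rewrite (single_neq y) ?mul1g ?mulg1 // -ik; apply/nesym.
Qed.

(** Induction on a list covering the finite support: dividing by the coordinate at [i] makes it
    trivial and leaves the others unchanged. *)
Lemma direct_product_ind (Q : direct_product G -> Prop) :
  Q 1 -> (forall i x y, Q y -> Q (direct_in_hom G i x * y)) -> forall x, Q x.
Proof.
move=> Q1 QM x.
have := set_mem (valP x); rewrite /finite_support /=.
move=> /(@finite_seqP {classic I})[s sx].
have {sx} : forall i, coord i x <> 1 -> (i : {classic I}) \in s.
  by move=> i xi; change ([set` s]%classic i); rewrite -sx.
elim: s x => [|i s IH] x xs.
  suff -> : x = 1 by [].
  by apply: coord_inj => i; rewrite gmulf1; apply: contrapT => /xs.
rewrite -(mulVKg (direct_in_hom G i (coord i x)) x); apply/QM/IH => j.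
rewrite gmulfM gmulfV coord_direct_in.
have [<-|ij] := pselect (i = j); first by rewrite single_same mulVg.
rewrite single_neq // invg1 mul1g => /xs; rewrite inE => /predU1P[ji|//].
by case: ij.
Qed.

End Coordinates.

(** * Products of letters that commute across different indices *)

Section CommutingFamily.
Variables (I : Type) (K : I -> groupType) (H : groupType).
Variable f : forall i, {hom K i -> H}.
Implicit Types l : seq {i : I & K i}.

Definition letters_prod l : H := \prod_(a <- l) f (projT1 a) (projT2 a).

(** Letters of index other than [i] contribute 1, so this multiplies the letters of index [i] in
    their order. *)
Definition letters_coord i l : K i := \prod_(a <- l) single (projT2 a) i.

(** Commutation is required only with the factors of other indices; inside its own factor the letter
    is arbitrary. *)
Definition central_letter (a : {i : I & K i}) : bool :=
  `[< forall j y, projT1 a <> j -> commute (f (projT1 a) (projT2 a)) (f j y) >].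

Let rest i l := [seq a <- l | ~~ `[< projT1 a = i >] ].

(** The letters of index [i] can be collected in front, since those of other indices commute with
    the image of [f i]. *)
Let letters_prod_rest i l : all central_letter l ->
  letters_prod l = f i (letters_coord i l) * letters_prod (rest i l).
Proof.
rewrite /letters_prod /letters_coord.
elim: l => [_|[j x] l IH /= /andP[/asboolP /= cx /IH e]].
  by rewrite !big_nil gmulf1 mulg1.
rewrite !big_cons /= e; case: asboolP => [ji|ji] /=.
  by subst j; rewrite single_same gmulfM mulgA.
by rewrite single_neq // mul1g big_cons /= !mulgA cx.
Qed.

Let letters_coord_rest i j l :
  letters_coord j (rest i l) = if `[< i = j >] then 1 else letters_coord j l.
Proof.
rewrite /letters_coord /rest big_filter; case: asboolP => [<-|ij].
  by apply: big1 => -[k x] /= /asboolPn ki; apply: single_neq.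
elim: l => [|[k x] l IH]; rewrite ?big_nil // !big_cons /= IH.
case: asboolP => //= ki; rewrite single_neq ?mul1g // ki; exact: ij.
Qed.

(** Collecting the letters that share the index of the first one splits off a trivial factor. The
    remaining word is shorter and its other coordinates are the same. *)
Lemma letters_prod_eq1 l :
  all central_letter l -> (forall i, f i (letters_coord i l) = 1) ->
  letters_prod l = 1.
Proof.
have [n] := ubnP (size l); elim: n l => // n IH [|[i x] l] ln lc l1.
  by rewrite /letters_prod big_nil.
rewrite (letters_prod_rest i lc) l1 mul1g; apply: IH => [||j].
- rewrite /= asboolT // size_filter.
  by apply: leq_ltn_trans (count_size _ _) _; rewrite -ltnS.
- by rewrite all_filter; apply: sub_all lc => a ca; apply/implyP.
- by rewrite letters_coord_rest; case: asboolP => // _; apply: gmulf1.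
Qed.

End CommutingFamily.

(** * Free presentations of the factors and of their products *)

Section SecondNilpotentProduct.
Variables (I : Type) (A S : I -> groupType) (c : forall i, {hom S i -> A i}).
Hypothesis cS : forall i y, exists x, c i x = y.
Hypothesis cZ : forall i x, c i x = 1 -> center_sg (S i) x.
Hypothesis cS' : forall i x, c i x = 1 -> derived_sg (S i) x.

Let Fi i : groupType := free_group (S i).
Let q i : {hom Fi i -> S i} := free_hom (@idfun (S i)).
Let r i : {hom Fi i -> A i} := c i \o q i.
Let RFi i : nsubgroup (Fi i) := commutator_sg (kernel_sg (r i)) (whole _).

(* The multiplier of A_i injects into S_i. *)
Hypothesis qK : forall i u, derived_sg (Fi i) u -> q i u = 1 -> RFi i u.

Let letter : Type := {i : I & S i}.
Let gen i (x : S i) : free_group letter := free_gen (existT S i x : letter).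
(** Being free on the disjoint union of the bases of the [Fi], this is their free product. It is
    also the free group of which [free_product S] is defined as a quotient, so [toP] is a coset
    map. *)
Let F : groupType := free_group letter.
Let P : groupType := free_product S.
Let G : groupType := direct_product A.
Let toP : {hom F -> P} := @cosetg _ _.
Let toA : {hom P -> G} :=
  free_product_hom (fun i => direct_in_hom A i \o c i).
Let p : {hom F -> G} := toA \o toP.
Let R : nsubgroup F := kernel_sg p.
Let RF : nsubgroup F := commutator_sg R (whole F).
Let U : groupType := quotient_group RF.
Let toU : {hom F -> U} := @cosetg _ RF.
Let iota i : {hom Fi i -> F} := free_hom (@gen i).
Let rho : {hom F -> direct_product Fi} :=
  free_hom
    (fun a : letter => direct_in_hom Fi (projT1 a) (free_gen (projT2 a))).

Let q_surj i x : exists u, q i u = x.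
Proof. by exists (free_gen x); rewrite free_homE. Qed.

Let toP_surj (x : P) : exists u, toP u = x.
Proof. by elim/coset_ind: x => u; exists u. Qed.

Let toP_gen i (x : S i) : toP (gen x) = free_in_hom S i x.
Proof. by []. Qed.

Let iota_gen i x : iota i (free_gen x) = gen x.
Proof. exact: free_homE. Qed.

Let q_gen i x : q i (free_gen x) = x.
Proof. exact: free_homE. Qed.

Let rho_gen i (x : S i) : rho (gen x) = direct_in_hom Fi i (free_gen x).
Proof. exact: free_homE. Qed.

Let p_gen i (x : S i) : p (gen x) = direct_in_hom A i (c i x).
Proof. exact: free_product_homE. Qed.

Let p_iota i u : p (iota i u) = direct_in_hom A i (r i u).
Proof.
apply: (@free_hom_eq _ _ (p \o iota i) (direct_in_hom A i \o r i)) => x.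
change (p (iota i (free_gen x)) = direct_in_hom A i (c i (q i (free_gen x)))).
by rewrite iota_gen p_gen q_gen.
Qed.

Let rho_iota i u : rho (iota i u) = direct_in_hom Fi i u.
Proof.
apply: (@free_hom_eq _ _ (rho \o iota i) (direct_in_hom Fi i)) => x.
exact: etrans (congr1 rho (iota_gen x)) (rho_gen x).
Qed.

Let coord_free_to_direct i u :
  coord S i (free_to_direct S (toP u)) = q i (coord Fi i (rho u)).
Proof.
apply: (@free_hom_eq _ _ (coord S i \o (free_to_direct S \o toP))
  (q i \o (coord Fi i \o rho))) => -[j x].
change (coord S i (free_to_direct S (toP (gen x))) =
  q i (coord Fi i (rho (gen x)))).
rewrite toP_gen free_product_homE rho_gen !coord_direct_in.
have [ji|ji] := pselect (j = i); last by rewrite !single_neq // gmulf1.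
by subst j; rewrite !single_same q_gen.
Qed.

Let coord_p i u : coord A i (p u) = r i (coord Fi i (rho u)).
Proof.
apply: (@free_hom_eq _ _ (coord A i \o p) (r i \o (coord Fi i \o rho))).
move=> -[j x].
change (coord A i (p (gen x)) = c i (q i (coord Fi i (rho (gen x))))).
rewrite p_gen rho_gen !coord_direct_in.
have [ji|ji] := pselect (j = i).
  by subst j; rewrite !single_same q_gen.
by rewrite !single_neq // !gmulf1.
Qed.

Let iota_RF i u : RFi i u -> RF (iota i u).
Proof.
apply: commutator_map => // x; change (r i x = 1 -> p (iota i x) = 1).
by rewrite p_iota => ->; apply: gmulf1.
Qed.

Let rho_RF i u : RF u -> RFi i (coord Fi i (rho u)).
Proof.
apply: (commutator_map (f := coord Fi i \o rho)) => // x.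
change (p x = 1 -> r i (coord Fi i (rho x)) = 1).
by rewrite -coord_p => ->; apply: gmulf1.
Qed.

Let toU_center u : p u = 1 -> center_sg U (toU u).
Proof. by move=> pu y; apply: (commutator_whole_center (N := R)). Qed.

Let p_iota_commutator i j u v : i <> j -> p [~ iota i u, iota j v] = 1.
Proof.
move=> ij; rewrite gmulfR !p_iota; apply/eqP/commgP.
exact: direct_in_commute.
Qed.

(** * Commutation modulo [R, F] and the normal subgroup Gamma *)

Let fU i : {hom Fi i -> U} := toU \o iota i.

(** Some [w] in F_i' has the same image as [u] in S_i. The quotient of [u] by [w] lies in R, hence
    is central in [U]. For [w] itself, the commutators of F_i with F_j lie in R, so
    [derived_commute] applies. *)
Let fU_commute i j u v :
  i <> j -> derived_sg (S i) (q i u) -> commute (fU i u) (fU j v).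
Proof.
move=> ij /(derived_surj (@q_surj i))[w w' qw].
rewrite -(mulVKg w u) gmulfM; apply/commute_sym/commuteM; apply/commute_sym.
  apply: derived_commute w' => x.
  change (center_sg U [~ toU (iota i x), toU (iota j v)]).
  rewrite -gmulfR; apply: toU_center.
  exact: p_iota_commutator.
apply: toU_center; rewrite p_iota.
change (direct_in_hom A i (c i (q i (w^-1 * u))) = 1).
by rewrite gmulfM gmulfV qw mulVg !gmulf1.
Qed.

(* Gamma is [R, F] times the subgroup generated by the q_i^-1(S_i'). *)
Let special (a : {i : I & Fi i}) : bool :=
  `[< derived_sg (S (projT1 a)) (q (projT1 a) (projT2 a)) >].

Let special_central l : all special l -> all (central_letter fU) l.
Proof.
apply: sub_all => a /asboolP qa; apply/asboolP => j y ij.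
exact: fU_commute.
Qed.

Let Gamma : set F :=
  [set u | exists2 l, all special l & toU u = letters_prod fU l]%classic.

Let Gamma_closed : group_closed [in Gamma].
Proof.
apply: group_closedP => [|u v [l ll ul] [k kk vk]|u [l ll ul]].
- by exists [::] => //; rewrite gmulf1 /letters_prod big_nil.
- exists (l ++ k); first by rewrite all_cat ll.
  by rewrite gmulfM ul vk /letters_prod big_cat.
exists [seq existT Fi (projT1 a) (projT2 a)^-1 | a <- rev l].
  rewrite all_map all_rev; apply: sub_all ll => a /asboolP qa.
  apply/asboolP.
  change (derived_sg (S (projT1 a)) (q (projT1 a) (projT2 a)^-1)).
  by rewrite gmulfV; apply: sgV.
rewrite gmulfV ul /letters_prod big_map -[in LHS](revK l) -prodgV.
by apply: eq_bigr => a _; rewrite gmulfV.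
Qed.

(** Conjugation by generators and their inverses suffices. One of the same index acts inside F_i,
    where the preimage of S_i' is normal; one of another index commutes with the letter by
    [fU_commute]. *)
Let special_conj a g : special a ->
  exists2 b, special b & fU (projT1 b) (projT2 b) =
    fU (projT1 a) (projT2 a) ^ toU g.
Proof.
have conj_gen (x : letter) b y : special b ->
    y = iota (projT1 x) (free_gen (projT2 x)) \/
    y = (iota (projT1 x) (free_gen (projT2 x)))^-1 ->
  exists2 b', special b' & fU (projT1 b') (projT2 b') =
    fU (projT1 b) (projT2 b) ^ toU y.
  case: x b => j x [i w] sb xy.
  have [v yv] : exists v, y = iota j v.
    by case: xy => ->; [exists (free_gen x)|exists (free_gen x)^-1];
      rewrite ?gmulfV.
  rewrite {}yv; have [ij|ij] := pselect (i = j).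
    subst j; exists (existT Fi i (w ^ v)); last by rewrite -!gmulfJ.
    move/asboolP: sb => sb; apply/asboolP.
    by change (derived_sg (S i) (q i (w ^ v))); rewrite gmulfJ; apply: nsg_conj.
  exists (existT Fi i w) => //=; apply/esym/conjg_fixP/commgP.
  by apply: fU_commute => //; apply/asboolP.
elim/free_group_ind: g a => [a sa|x g IH a sa|x g IH a sa].
- by exists a; rewrite // gmulf1 conjg1.
- have [|b sb eb] := conj_gen x a (gen (projT2 x)) sa.
    by left; rewrite iota_gen.
  have [b' sb' eb'] := IH b sb; exists b' => //.
  by rewrite eb' eb gmulfM conjgM; case: (x).
- have [|b sb eb] := conj_gen x a (gen (projT2 x))^-1 sa.
    by right; rewrite iota_gen.
  have [b' sb' eb'] := IH b sb; exists b' => //.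
  by rewrite eb' eb gmulfM conjgM; case: (x).
Qed.

Let Gamma_conj u g : Gamma u -> Gamma (u ^ g).
Proof.
move=> [l ll ul]; suff [k kk ek] : exists2 k, all special k &
    letters_prod fU k = letters_prod fU l ^ toU g.
  by exists k => //; rewrite gmulfJ ul.
rewrite /letters_prod {u ul}.
elim: l ll => [_|a l IH /andP[/(special_conj g)[b sb eb] /IH[k kk ek]]].
  by exists [::]; rewrite // !big_nil conj1g.
exists (b :: k); first by rewrite /= sb.
by rewrite !big_cons conjMg eb ek.
Qed.

Let GammaN : nsubgroup F := @NSubgroup F (Subgroup Gamma_closed) Gamma_conj.

Let Gamma_RF u : RF u -> GammaN u.
Proof.
by move=> /coset1P RFu; exists [::]; rewrite // /letters_prod big_nil.
Qed.

Let Gamma_iota i u : derived_sg (S i) (q i u) -> GammaN (iota i u).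
Proof.
move=> qu; exists [:: existT Fi i u]; last by rewrite /letters_prod big_seq1.
by rewrite /= andbT; apply/asboolP.
Qed.

(** * The quotient by Gamma has class at most 2 *)

Let V : groupType := quotient_group GammaN.

Let toV : {hom F -> V} := @cosetg _ GammaN.

Let toV_R_center u : p u = 1 -> center_sg V (toV u).
Proof.
move=> pu; elim/coset_ind => v; apply/commgP/eqP; rewrite -gmulfR.
by apply/coset1P/Gamma_RF/sub_generated; exists u, v.
Qed.

(** The quotient of [V] by its center is abelian, as seen on generators: commutators of generators
    of equal index lie in Gamma, and those of different indices lie in R, which is central in
    [V]. *)
Let commutator_V_center (x y : V) : center_sg V [~ x, y].
Proof.
pose toW : {hom V -> quotient_group (center_nsg V)} := @cosetg _ _.
have cF : forall u v : F, commute ((toW \o toV) u) ((toW \o toV) v).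
  apply: free_commute => -[i a] [j b].
  change (commute (toW (toV (gen a))) (toW (toV (gen b)))).
  apply/commgP/eqP; rewrite -!gmulfR; apply/coset1P.
  have [ij|ij] := pselect (i = j).
    subst j; suff -> : toV [~ gen a, gen b] = 1 by apply: sg1.
    apply/coset1P; rewrite -!iota_gen -gmulfR; apply: Gamma_iota.
    by rewrite gmulfR; apply: sub_generated; do 2!eexists.
  by apply: toV_R_center; rewrite -!iota_gen; apply: p_iota_commutator.
elim/coset_ind: x => u; elim/coset_ind: y => v.
by apply/(coset1P (center_nsg V)); rewrite gmulfR; apply/eqP/commgP/cF.
Qed.

Let gamma3_V x : gamma3 V x -> x = 1.
Proof.
(* The kernel of the identity serves as the trivial subgroup. *)
apply: (@commutator_min V (derived_sg V) (whole V)
  (kernel_sg (idfun : {hom V -> V}))) => h k h' _.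
apply/eqP/commgP.
exact: (derived_min (N := center_nsg V) commutator_V_center h' k).
Qed.

(** The relators of the free product are images of elements of the kernels of the [q i], so they lie
    in Gamma. Hence [toV] factors through [P], and gamma_3 of [P] goes to that of [V], which is
    trivial. *)
Let gamma3_Gamma u : gamma3 P (toP u) -> GammaN u.
Proof.
have relV : (normal_closure (free_product_relators (G := S)) `<=`
    kernel_sg toV)%classic.
  apply: normal_closure_min => _ [i [a [b ->]]]; apply/coset1P.
  change (GammaN (gen a * gen b * (gen (a * b))^-1)).
  rewrite -!iota_gen -gmulfV -!gmulfM; apply: Gamma_iota.
  by rewrite !gmulfM gmulfV !q_gen mulgV; apply: sg1.
move=> u3; apply/coset1P; change (toV u = 1).
have <- : quotient_hom relV (toP u) = toV u by apply: quotient_homE.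
apply: gamma3_V; apply: commutator_map u3 => // x.
exact: derived_map.
Qed.

Let coord_rho_letters i (l : seq {i : I & Fi i}) :
  coord Fi i (rho (\prod_(a <- l) iota (projT1 a) (projT2 a))) =
  letters_coord i l.
Proof.
rewrite !gmulf_prod; apply: eq_bigr => a _.
by rewrite rho_iota coord_direct_in.
Qed.

(** Modulo [R, F], [u] is a product of special letters, whose coordinates differ from those of [u]
    by elements of [R_i, F_i]. So each coordinate of the product dies in [U], and [letters_prod_eq1]
    applies. *)
Let RF_of_coord u : GammaN u -> (forall i, RFi i (coord Fi i (rho u))) -> RF u.
Proof.
move=> [l ll ul] cu; apply/coset1P; rewrite -/(toU u) ul.
apply: letters_prod_eq1; first exact: special_central.
move=> i; apply/coset1P/iota_RF; rewrite -coord_rho_letters.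
rewrite -[X in coord _ _ (rho X)](mulVKg u) !gmulfM; apply: sgM => //.
rewrite -!gmulfM; apply/rho_RF/cosetP; rewrite -/(toU u) ul /letters_prod.
by rewrite -[RHS]/(toU _) gmulf_prod.
Qed.

(** In the abelian group P/P' all letters commute, so the image of [x] is determined by its
    coordinates, and those in S_i' die. *)
Let derived_of_coord (x : P) :
  (forall i, derived_sg (S i) (coord S i (free_to_direct S x))) ->
  derived_sg P x.
Proof.
have ab (y z : quotient_group (derived_sg P)) : commute y z.
  elim/coset_ind: y => y; elim/coset_ind: z => z; apply/commgP/eqP.
  by rewrite -gmulfR; apply/coset1P/sub_generated; exists y, z.
have [l ->] : exists l : seq letter,
    x = \prod_(a <- l) free_in_hom S (projT1 a) (projT2 a).
  have [u <-] := toP_surj x; elim/free_group_ind: u {x} => [|a u|a u].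
  - by exists [::]; rewrite big_nil gmulf1.
  - by move=> [l ul]; exists (a :: l); rewrite big_cons gmulfM ul; case: a.
  case: a => i a [l ul]; exists (existT _ i a^-1 :: l).
  by rewrite big_cons gmulfM ul !gmulfV.
move=> cx; apply/coset1P; rewrite gmulf_prod.
pose f i : {hom S i -> quotient_group (derived_sg P)} :=
  cosetg (derived_sg P) \o free_in_hom S i.
apply: (letters_prod_eq1 (f := f)).
  by elim: l {cx} => //= a l ->; rewrite andbT; apply/asboolP => *; apply: ab.
move=> i; apply/coset1P/derived_map.
have := cx i; rewrite !gmulf_prod; congr (derived_sg _ _).
by apply: eq_bigr => a _; rewrite free_product_homE coord_direct_in.
Qed.

(** * The second nilpotent product as a central extension of G *)

Let SN : groupType := second_nilpotent_product S.
Let N : nsubgroup P := sgI (gamma3 P) (kernel_sg (free_to_direct S)).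
Let toSN : {hom P -> SN} := @cosetg _ _.

Let N_toA : (N `<=` kernel_sg toA)%classic.
Proof.
move=> x [_]; have [u <-] := toP_surj x => xD.
apply: coord_inj => i; rewrite gmulf1 -[LHS]/(coord A i (p u)) coord_p.
change (c i (q i (coord Fi i (rho u))) = 1).
by rewrite -coord_free_to_direct xD !gmulf1.
Qed.

Let cbar : {hom SN -> G} := quotient_hom N_toA.
Let cbarE u : cbar (toSN (toP u)) = p u.
Proof. exact: quotient_homE. Qed.

Let p_surj x : exists u, p u = x.
Proof.
elim/direct_product_ind: x => [|i x y [u <-]].
  by exists 1; apply: gmulf1.
have [s <-] := cS x; exists (gen s * u).
by rewrite gmulfM p_gen.
Qed.

Let toSN_surj x : exists u, (toSN \o toP) u = x.
Proof.
by elim/coset_ind: x => x; have [u <-] := toP_surj x; exists u.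
Qed.

Let R_derived u : p u = 1 -> derived_sg P (toP u).
Proof.
move=> pu; apply: derived_of_coord => i; rewrite coord_free_to_direct.
by apply: cS'; have := coord_p i u; rewrite pu gmulf1.
Qed.

(** A commutator with an element over 1 is in gamma_3(P) because [R_derived] puts that element in
    P'. It dies in the direct product of the S_i because the coordinates of the element lie in the
    kernels of the [c i], which are central. *)
Let cbar_center x : cbar x = 1 -> center_sg SN x.
Proof.
have [u <-] := toSN_surj x; rewrite cbarE => pu y.
have [v <-] := toSN_surj y; apply/commgP/eqP; rewrite -!gmulfR.
apply/coset1P; split.
  rewrite gmulfR; apply: sub_generated; exists (toP u), (toP v).
  by split=> //; apply: R_derived.
apply: coord_inj => i; rewrite coord_free_to_direct !gmulfR !gmulf1.
apply/eqP/commgP/cZ.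
by have := coord_p i u; rewrite pu gmulf1.
Qed.

Let cbar_derived x : cbar x = 1 -> derived_sg SN x.
Proof.
have [u <-] := toSN_surj x; rewrite cbarE => pu.
exact/(derived_map toSN)/R_derived.
Qed.

Let toSN_kernel u : derived_sg F u -> (toSN \o toP) u = 1 -> RF u.
Proof.
move=> u' /coset1P[u3 uD]; apply: RF_of_coord => [|i].
  exact: gamma3_Gamma.
apply: qK; first exact: (derived_map (coord Fi i \o rho)).
by rewrite -coord_free_to_direct uD gmulf1.
Qed.

Lemma second_nilpotent_product_covering :
  is_covering_group (second_nilpotent_product S) (direct_product A).
Proof.
exists (kernel_sg cbar); split.
- pose f := quotient_hom (N := kernel_sg cbar) (f := cbar)
    (fun x => id).
  exists f; apply: inj_surj_bijective => [|y].
    apply: gmulf_inj; elim/coset_ind => x; rewrite quotient_homE => cx.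
    exact/coset1P.
  have [u <-] := p_surj y; exists (cosetg _ (toSN (toP u))).
  by rewrite quotient_homE cbarE.
- by move=> x cx; split; [apply: cbar_center|apply: cbar_derived].
(* By independence of the presentation, the multiplier of [G] may be computed from [p]. *)
apply: isomorphic_trans (isomorphic_sym (schur_multiplier_indep p_surj)).
by apply: (isomorphic_hopf_group (q := toSN \o toP) (c := cbar)).
Qed.

End SecondNilpotentProduct.

Theorem corollary4p4 (I : Type) (A : I -> finGroupType)
    (Astar : I -> groupType)
    (hA : forall i : I, is_covering_group (Astar i) (A i)) :
  is_covering_group (second_nilpotent_product Astar)
    (direct_product (fun i : I => (A i : groupType))).
Proof.
(* The last clause expresses that the multiplier of [A i] injects into [Astar i]; this is where the
   finiteness of [A i] enters. *)
have cP i : exists c : {hom Astar i -> A i},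
    [/\ forall y, exists x, c x = y,
        forall x, c x = 1 -> center_sg (Astar i) x,
        forall x, c x = 1 -> derived_sg (Astar i) x
      & forall u, derived_sg _ u -> free_hom (@idfun (Astar i)) u = 1 ->
          commutator_sg (kernel_sg (c \o free_hom (@idfun (Astar i))))
            (whole _) u].
  have [B [[f [g fK gK]] BZ Biso]] := hA i.
  pose c : {hom Astar i -> A i} := f \o cosetg B.
  have cB x : B x <-> c x = 1.
    split=> [/coset1P Bx|cx]; first by rewrite /c /= Bx gmulf1.
    by apply/coset1P/(can_inj fK); rewrite gmulf1.
  have cS y : exists x, c x = y.
    rewrite -(gK y); by elim/coset_ind: (g y) => x; exists x.
  have qS (x : Astar i) : exists u, free_hom (@idfun (Astar i)) u = x.
    by exists (free_gen x); rewrite free_homE.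
  exists c; split=> // [x /cB/BZ[]|x /cB/BZ[]|] //.
  apply: (hopf_comparison_inj (c := c) (B := B)) => // [x /BZ[]|x /BZ[]|] //.
  (* The multiplier in the covering data is presented on the elements of [A i]; it is transferred to
     the presentation on the elements of [Astar i], which is onto [A i] because [c] is. *)
  apply: isomorphic_trans Biso (schur_multiplier_indep _) => y.
  have [x <-] := cS y; by have [u <-] := qS x; exists u.
pose c i := sval (cid (cP i)).
by apply: (second_nilpotent_product_covering (c := c)) => i;
  have [] := svalP (cid (cP i)).
Qed.
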